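(* Let $L$ be a finite signature, let $\mathfrak{K}_0$ be a class of $L$-structures with domain $\omega$ (closed under isomorphism among structures with domain $\omega$), and let $\nu$ be an effective enumeration of $\mathfrak{K}_0$. Let $\mathfrak{K} = \{\mathcal{B}_i : i\in\omega\}$ be a family with $\mathfrak{K}\subseteq\mathfrak{K}_0$ (together with all isomorphic copies with domain $\omega$), where the structures $\mathcal{B}_i$ are infinite and pairwise non-isomorphic. Then the following are equivalent: (1) the class $\mathfrak{K}$ is $\mathbf{InfEx}_{\cong}[\nu]$-learnable; (2) there is a sequence $(\psi_i)_{i\in\omega}$ of $\Sigma^{\mathrm{inf}}_2$ sentences in the signature $L$ such that for all $i,j\in\omega$, $\mathcal{B}_j\models\psi_i$ if and only if $i=j$.
   Context: Relational signatures: if $L$ has function or constant symbols, they are replaced by their graphs. Let $L=\{P_0^{n_0},\dots,P_k^{n_k}\}$. An $L$-informant is a function $I$ on $\omega$ with $I(m)=(I_0(m),\dots,I_k(m))$, $I_j(m)\in\omega^{n_j}\times\{0,1\}$. $I$ is an informant for the $L$-structure $\mathcal{S}=(\omega;P_0,\dots,P_k)$ if for every $j\le k$, the range of $I_j$ equals $\{(\bar a,1):\bar a\in P_j\}\cup\{(\bar a,0):\bar a\in\omega^{n_j}\setminus P_j\}$. $I[n]$ denotes $I(0),\dots,I(n-1)$. A learner is a function $M$ from finite initial segments of informants to $\omega\cup\{?\}$. An effective enumeration of a class $\mathfrak{K}_0$ is a map $\nu:\omega\to\mathfrak{K}_0$ such that $(\nu(e))_{e\in\omega}$ is a uniformly computable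 sequence of structures and every member of $\mathfrak{K}_0$ is isomorphic to some $\nu(e)$. For $\mathfrak{C}\subseteq\mathfrak{K}_0$ (closed under isomorphism), $\mathfrak{C}$ is $\mathbf{InfEx}_{\cong}[\nu]$-learnable if there is a learner $M$ (no computability required) such that for every $\mathcal{A}\in\mathfrak{C}$ and every informant $I$ for $\mathcal{A}$ there are $e,s_0$ with $\nu(e)\cong\mathcal{A}$ and $M(I[s])=e$ for all $s\ge s_0$. Infinitary formulas: $\Sigma^{\mathrm{inf}}_0=\Pi^{\mathrm{inf}}_0$ are finitary quantifier-free formulas; a $\Sigma^{\mathrm{inf}}_n$ formula $\psi(\bar x)$ is a countable disjunction $\bigvee_{i\in I}\exists\bar y_i\,\xi_i(\bar x,\bar y_i)$ with each $\xi_i$ a $\Pi^{\mathrm{inf}}_{m}$ formula for some $m<n$; a $\Pi^{\mathrm{inf}}_n$ formula is a countable conjunction $\bigwedge_{i\in I}\forall\bar y_i\,\xi_i(\bar x,\bar y_i)$ with each $\xi_i$ a $\Sigma^{\mathrm{inf}}_m$ formula for some $m<n$ (all with finitely many free variables). *)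

(* Defs.v *)
From HB Require Import structures.
From mathcomp Require Import all_boot.

Set Implicit Arguments.
Unset Strict Implicit.
Unset Printing Implicit Defensive.

(* A finite relational signature P_0, ..., P_k. Function and constant symbols
   are represented by the relation symbols of their graphs. *)
Record signature : Type := Signature {
  last_sym : nat;
  arity : 'I_last_sym.+1 -> nat
}.

Definition symbol (L : signature) := 'I_(last_sym L).+1.

(* The domain of a structure is always nat, so every structure is infinite. *)
Definition structure (L : signature) : Type :=
  forall j : symbol L, (arity j).-tuple nat -> Prop.

Definition iso (L : signature) (S T : structure L) : Prop :=
  exists2 f : nat -> nat, bijective f
    & forall (j : symbol L) (a : (arity j).-tuple nat),
        S j a <-> T j (map_tuple f a).

Definition iso_closed (L : signature) (C : structure L -> Prop) : Prop :=
  forall S T : structure L, iso S T -> C S -> C T.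

Definition iso_class (L : signature) (B : nat -> structure L)
    (S : structure L) : Prop :=
  exists i, iso (B i) S.

(* Mu-recursive functions: a code of type [rec n] denotes a partial n-ary
   function on nat. *)
Inductive rec : nat -> Type :=
| RZero n : rec n
| RSucc : rec 1
| RProj n (i : 'I_n) : rec n
| RComp n m (f : rec m) (g : 'I_m -> rec n) : rec n
| RPrim n (f : rec n) (g : rec n.+2) : rec n.+1
| RMin n (f : rec n.+1) : rec n.

(* [rec_eval c v y]: the function coded by [c] converges on [v] with value [y].
   The recursion variable of [RPrim] and the search variable of [RMin] come
   first; the step function of [RPrim] receives the recursion variable, the
   previous value and then the parameters. *)
Fixpoint rec_eval n (c : rec n) : n.-tuple nat -> nat -> Prop :=
  match c in rec n return n.-tuple nat -> nat -> Prop with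
  | RZero _ => fun _ y => y = 0
  | RSucc => fun v y => y = (thead v).+1
  | RProj _ i => fun v y => y = tnth v i
  | @RComp _ m f g => fun v y =>
      exists w : m.-tuple nat,
        (forall i, rec_eval (g i) v (tnth w i)) /\ rec_eval f w y
  | @RPrim n f g => fun v y =>
      let u : n.-tuple nat := behead_tuple v in
      (fix loop (t z : nat) : Prop :=
         match t with
         | 0 => rec_eval f u z
         | t'.+1 => exists2 r, loop t' r & rec_eval g [tuple of t' :: r :: u] z
         end) (thead v) y
  | RMin _ f => fun v y =>
      rec_eval f [tuple of y :: v] 0 /\
      forall x, x < y -> exists z, rec_eval f [tuple of x :: v] z.+1
  end.

Definition computable_rel n (R : n.-tuple nat -> Prop) : Prop :=
  exists c : rec n, forall v : n.-tuple nat,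
    (R v -> rec_eval c v 1) /\ (~ R v -> rec_eval c v 0).

(* The index e is the first argument of the relation. As the signature is
   finite, asking for one program per symbol is the same as asking for a single
   program that also takes the symbol as input. *)
Definition uniformly_computable (L : signature) (nu : nat -> structure L) :=
  forall j : symbol L,
    @computable_rel (arity j).+1 (fun v => nu (thead v) j (behead_tuple v)).

Definition effective_enumeration (L : signature) (K0 : structure L -> Prop)
    (nu : nat -> structure L) : Prop :=
  [/\ forall e, K0 (nu e),
      uniformly_computable nu
    & forall S, K0 S -> exists e, iso S (nu e)].

(* One value I(m) = (I_0(m), ..., I_k(m)) of an informant; the bit 1 is [true]. *)
Definition datum (L : signature) : Type :=
  {dffun forall j : symbol L, ((arity j).-tuple nat * bool)%type}.

Definition informant (L : signature) : Type := nat -> datum L.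

Definition informant_for (L : signature) (I : informant L) (S : structure L) :=
  forall (j : symbol L) (a : (arity j).-tuple nat) (b : bool),
    (exists m, I m j = (a, b)) <-> (b = true /\ S j a \/ b = false /\ ~ S j a).

(* [None] is the answer "?". Every finite sequence of data is an initial segment
   of some informant. *)
Definition learner (L : signature) : Type := seq (datum L) -> option nat.

Definition InfEx_learnable (L : signature) (nu : nat -> structure L)
    (C : structure L -> Prop) : Prop :=
  exists M : learner L,
    forall S : structure L, C S ->
    forall I : informant L, informant_for I S ->
    exists e s0 : nat,
      iso (nu e) S /\ forall s, s0 <= s -> M (mkseq I s) = Some e.

(* Finitary quantifier-free formulas with free variables x_0, ..., x_{n-1}. *)
Inductive qform (L : signature) (n : nat) : Type :=
| QFalse
| QEq (x y : 'I_n)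
| QRel (j : symbol L) (x : (arity j).-tuple 'I_n)
| QNot (f : qform L n)
| QAnd (f g : qform L n)
| QOr (f g : qform L n).

Fixpoint qsat (L : signature) (S : structure L) n (v : n.-tuple nat)
    (f : qform L n) : Prop :=
  match f with
  | QFalse => False
  | QEq x y => tnth v x = tnth v y
  | QRel j x => S j (map_tuple (tnth v) x)
  | QNot f => ~ qsat S v f
  | QAnd f g => qsat S v f /\ qsat S v g
  | QOr f g => qsat S v f \/ qsat S v g
  end.

(* Infinitary formulas with n free variables. [IDisj] is the countable
   disjunction over i of "exists y_i, f i", where y_i is a tuple of [k i] fresh
   variables numbered n, ..., n + k i - 1; [IConj] is its dual. *)
Inductive iform (L : signature) : nat -> Type :=
| IQf n (f : qform L n) : iform L n
| IDisj n (J : countType) (k : J -> nat) (f : forall i, iform L (n + k i)) :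
    iform L n
| IConj n (J : countType) (k : J -> nat) (f : forall i, iform L (n + k i)) :
    iform L n.

Fixpoint isat (L : signature) (S : structure L) n (f : iform L n) :
    n.-tuple nat -> Prop :=
  match f in iform _ n return n.-tuple nat -> Prop with
  | IQf _ f => fun v => qsat S v f
  | @IDisj _ _ J k f => fun v =>
      exists (i : J) (y : (k i).-tuple nat), isat S (f i) [tuple of v ++ y]
  | @IConj _ _ J k f => fun v =>
      forall (i : J) (y : (k i).-tuple nat), isat S (f i) [tuple of v ++ y]
  end.

Fixpoint is_Sigma (L : signature) (l : nat) n (f : iform L n) : Prop :=
  match f with
  | IQf _ _ => l = 0
  | @IDisj _ _ J _ f => 0 < l /\ forall i : J, exists2 m, m < l & is_Pi m (f i)
  | IConj _ _ _ _ => False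
  end
with is_Pi (L : signature) (l : nat) n (f : iform L n) : Prop :=
  match f with
  | IQf _ _ => l = 0
  | IDisj _ _ _ _ => False
  | @IConj _ _ J _ f => 0 < l /\ forall i : J, exists2 m, m < l & is_Sigma m (f i)
  end.

Definition sentence (L : signature) : Type := iform L 0.

Definition models (L : signature) (S : structure L) (f : sentence L) : Prop :=
  isat S f [tuple].

(* Main.v *)
Require Import Defs.
From HB Require Import structures.
From mathcomp Require Import all_boot boolp.

(* From Sigma_2 sentences to a learner: psi_i is a countable disjunction over
   (disjunct, witness) pairs of Pi_1 statements, and a Pi_1 statement that fails
   in a structure is refuted by a finite part of any informant. The learner
   answers with the i of the least not yet refuted pair.

   From a learner M to Sigma_2 sentences: each B_i has a finite sequence s and a
   tuple y naming the numbers in s such that M never changes its mind on any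
   continuation of s that is realized in B_i by a continuation of y; otherwise
   an informant for some copy of B_i would make M diverge. The sentence psi_i
   says that some y realizes s and that no continuation of (s, y) makes M answer
   anything else than its limit on B_i. If B_j satisfies psi_i, then on a copy of
   B_j with an informant extending s, M converges to the same answer, hence B_i
   and B_j are isomorphic. *)

Set Implicit Arguments.
Unset Strict Implicit.
Unset Printing Implicit Defensive.

(** * Isomorphisms and invariance of satisfaction *)

Lemma map_tuple_comp (A B C : Type) n (g : B -> C) (f : A -> B) (a : n.-tuple A) :
  map_tuple g (map_tuple f a) = map_tuple (g \o f) a.
Proof. by apply: val_inj; rewrite /= map_comp. Qed.

Lemma map_tuple_id (A : Type) n (f : A -> A) (a : n.-tuple A) :
  f =1 id -> map_tuple f a = a.
Proof. by move=> fE; apply: val_inj; rewrite /= (eq_map fE) map_id. Qed.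

Lemma iso_refl (L : signature) (S : structure L) : iso S S.
Proof.
exists id; first by exists id.
by move=> j a; rewrite map_tuple_id.
Qed.

Lemma iso_sym (L : signature) (S T : structure L) : iso S T -> iso T S.
Proof.
move=> [f [g fK gK] ST]; exists g; first by exists f.
by move=> j a; rewrite ST map_tuple_comp map_tuple_id.
Qed.

Lemma iso_trans (L : signature) (S T U : structure L) :
  iso S T -> iso T U -> iso S U.
Proof.
move=> [f fB ST] [g gB TU]; exists (g \o f); first exact: bij_comp.
by move=> j a; rewrite ST TU map_tuple_comp.
Qed.

Lemma qsat_inj (L : signature) (S T : structure L) (h : nat -> nat) :
    injective h -> (forall j a, S j a <-> T j (map_tuple h a)) ->
  forall n (f : qform L n) v, qsat S v f <-> qsat T (map_tuple h v) f.
Proof.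
move=> hI ST n f v; elim: f => //= [x y|j x|f IHf|f IHf g IHg|f IHf g IHg].
- by rewrite !tnth_map; split=> [->|/hI].
- rewrite ST map_tuple_comp.
  suff -> : map_tuple (h \o tnth v) x = map_tuple (tnth (map_tuple h v)) x by [].
  by apply: val_inj; apply: eq_map => i /=; rewrite tnth_map.
- by rewrite IHf.
- by rewrite IHf IHg.
- by rewrite IHf IHg.
Qed.

Lemma isat_iso (L : signature) (S T : structure L) (h : nat -> nat) :
    bijective h -> (forall j a, S j a <-> T j (map_tuple h a)) ->
  forall n (f : iform L n) v, isat S f v <-> isat T f (map_tuple h v).
Proof.
move=> [g hK gK] ST.
have cat_h n k (v : n.-tuple nat) (y : k.-tuple nat) :
    map_tuple h [tuple of v ++ y] = [tuple of map_tuple h v ++ map_tuple h y].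
  by apply: val_inj; rewrite /= map_cat.
have map_hg k (y : k.-tuple nat) : map_tuple h (map_tuple g y) = y.
  by rewrite map_tuple_comp map_tuple_id.
move=> n; elim=> {n} [n f|n J k f IH|n J k f IH] v /=.
- exact: qsat_inj (can_inj hK) ST n f v.
- split=> -[i [y sat]]; exists i.
    by exists (map_tuple h y); rewrite -cat_h -IH.
  by exists (map_tuple g y); rewrite IH cat_h map_hg.
- split=> sat i y; last by rewrite IH cat_h; apply: sat.
  by rewrite -[y]map_hg -cat_h -IH.
Qed.

Lemma models_iso (L : signature) (S T : structure L) (f : sentence L) :
  iso S T -> models S f <-> models T f.
Proof.
move=> [h hB ST]; rewrite /models (isat_iso hB ST).
by rewrite [map_tuple h _]tuple0.
Qed.

(** * Finite data and informants *)

Definition consistent (L : signature) (S : structure L) (s : seq (datum L)) :=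
  forall d, d \in s -> forall j,
    if (d j).2 then S j (d j).1 else ~ S j (d j).1.

Lemma consistent_cat (L : signature) (S : structure L) (s t : seq (datum L)) :
  consistent S (s ++ t) <-> consistent S s /\ consistent S t.
Proof.
split=> [C|[Cs Ct] d]; last by rewrite mem_cat => /orP[/Cs|/Ct].
by split=> d ds; apply: C; rewrite mem_cat ds ?orbT.
Qed.

Lemma consistent_mkseqW (L : signature) (S : structure L) I m n :
  m <= n -> consistent S (mkseq I n) -> consistent S (mkseq I m).
Proof.
move=> mn C d /mapP[i]; rewrite mem_iota /= => im ->.
by apply: C; rewrite map_f // mem_iota /= (leq_trans im mn).
Qed.

Lemma informant_consistent (L : signature) (S : structure L) I n :
  informant_for I S -> consistent S (mkseq I n).
Proof.
move=> IS d /mapP[i _ ->] j; case E: (I i j) => [a b] /=.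
have [+ _] := IS j a b.
by case=> [|[-> //]|[-> //]]; exists i.
Qed.

Lemma informant_exists (L : signature) (S : structure L) :
  exists I, informant_for I S.
Proof.
pose tup (j : symbol L) m : (arity j).-tuple nat :=
  odflt [tuple of nseq _ 0] (unpickle m).
exists (fun m => [ffun j => (tup j m, `[< S j (tup j m) >])]) => j a b.
split=> [[m]|Sb].
  rewrite ffunE => -[<- <-].
  by case: asboolP; [left|right].
exists (pickle a); rewrite ffunE /tup pickleK /=; congr pair.
by case: asboolP => Sa; case: Sb => -[].
Qed.

(** Informants may repeat data, so putting true data in front of one does not change its range. *)
Lemma informant_prepend (L : signature) (S : structure L) s I :
    consistent S s -> informant_for I S ->
  exists2 I', informant_for I' S &
    forall n, exists t, mkseq I' (size s + n) = s ++ t.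
Proof.
move=> Cs IS.
pose I' m := if m < size s then nth (I 0) s m else I (m - size s).
exists I'; last first.
  move=> n; exists (mkseq I n); rewrite /mkseq iotaD map_cat; congr cat.
    apply: (@eq_from_nth _ (I 0)); rewrite size_map size_iota // => i lti.
    by rewrite (nth_map 0) ?size_iota // nth_iota // /I' lti.
  rewrite add0n -[X in iota X]addn0 iotaDl -map_comp; apply: eq_map => i /=.
  by rewrite /I' ltnNge leq_addr addKn.
move=> j a b; split=> [[m]|/IS[m Im]].
  rewrite /I'; case: ifP => [ms E|_ E]; last by apply/IS; exists (m - size s).
  have := Cs _ (mem_nth (I 0) ms) j; rewrite E /=.
  by case: (b); [left|right].
by exists (size s + m); rewrite /I' ltnNge leq_addr addKn.
Qed.

(** * Refutable properties and the learner built from sentences *)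

(** The finite data must exclude [P] in every structure consistent with them, since a learner sees
    the data and not [S]. *)
Definition refutable (L : signature) (P : structure L -> Prop) :=
  forall S I, informant_for I S -> ~ P S ->
  exists s0, forall T, consistent T (mkseq I s0) -> ~ P T.

Lemma qsat_local (L : signature) (S : structure L) I n (v : n.-tuple nat)
    (f : qform L n) :
    informant_for I S ->
  exists s0, forall T, consistent T (mkseq I s0) -> (qsat T v f <-> qsat S v f).
Proof.
move=> IS; elim: f => /= [|x y|j x|f [s fP]|f [s fP] g [t gP]|f [s fP] g [t gP]].
- by exists 0.
- by exists 0.
- set a := map_tuple _ _.
  have [m Im] : exists m, I m j = (a, `[< S j a >]).
    by apply/IS; case: asboolP; [left|right].
  exists m.+1 => T /(_ (I m)) C; have {C} := C _ j.
  rewrite map_f ?mem_iota //= Im /= => /(_ isT).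
  by case: asboolP.
- by exists s => T /fP->.
- exists (maxn s t) => T C.
  by rewrite fP ?gP //; apply: consistent_mkseqW C; rewrite ?leq_maxl ?leq_maxr.
- exists (maxn s t) => T C.
  by rewrite fP ?gP //; apply: consistent_mkseqW C; rewrite ?leq_maxl ?leq_maxr.
Qed.

(** A failing conjunct has a counterexample, and a quantifier-free formula at a fixed tuple depends
    on finitely many atomic facts, all decided by some initial segment of the informant. *)
Lemma Pi1_refutable (L : signature) n m (f : iform L n) (v : n.-tuple nat) :
  m < 2 -> is_Pi m f -> refutable (fun S => isat S f v).
Proof.
move=> m2; case: f v => {n} [n f|//|n J k f] v /=.
  move=> _ S I IS nS; have [s fP] := qsat_local v f IS.
  by exists s => T /fP ->.
move=> [m0 fS] S I IS /existsNP[i /existsNP[y]].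
have {fS} [m' m'm] := fS i.
have -> : m' = 0 by case: m m2 m'm m0 => [|[|]] // _; case: m'.
move=> fi nS; suff [s sP] : exists s, forall T, consistent T (mkseq I s) ->
    ~ isat T (f i) [tuple of v ++ y].
  by exists s => T /sP nT sat; apply: nT.
case: (f i) [tuple of _] fi nS => [n' g|n' J' k' g|//] w /=; last by case.
move=> _ nS; have [s gP] := qsat_local w g IS.
by exists s => T /gP ->.
Qed.

(** A disjunct and its existential witness are coded by one number. Numbers that code nothing get
    the empty property, which is trivially refutable. *)
Lemma Sigma2_refutable_cover (L : signature) n (f : iform L n)
    (v : n.-tuple nat) :
    is_Sigma 2 f ->
  exists P : nat -> structure L -> Prop, (forall c, refutable (P c)) /\
    forall S, isat S f v <-> exists c, P c S.
Proof.
case: f v => {n} // n J k f v /= [_ fP].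
pose P c S := if unpickle c is Some (existT i y)
  then isat S (f i) [tuple of v ++ (y : (k i).-tuple nat)] else False.
exists P; split=> [c|S]; rewrite /P.
  case: unpickle => [[i y]|]; last by move=> S I _ _; exists 0 => T _ [].
  by have [m m2 Pim] := fP i; apply: Pi1_refutable _ m2 Pim.
split=> [[i [y sat]]|[c]]; last by case: unpickle => // -[i y]; exists i, y.
by exists (pickle (existT (fun i => (k i).-tuple nat) i y)); rewrite pickleK.
Qed.

Lemma learnable_of_Sigma2 (L : signature) (nu B : nat -> structure L)
    (psi : nat -> sentence L) :
    (forall i, exists e, iso (nu e) (B i)) ->
    (forall i, is_Sigma 2 (psi i)) ->
    (forall i j, models (B j) (psi i) <-> i = j) ->
  InfEx_learnable nu (iso_class B).
Proof.
move=> nuB; have [E EP] := choice nuB; move=> psi2 psiP.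
have [P PP] := choice (fun i => Sigma2_refutable_cover [tuple] (psi2 i)).
pose decode c : option (nat * nat) := unpickle c.
pose Q c T := if decode c is Some (i, c') then P i c' T else False.
(* Quantifying over all structures is harmless, as the learner need not be computable. Codes that
   decode to nothing are always refuted. *)
pose refuted c (s : seq (datum L)) := forall T, consistent T s -> ~ Q c T.
have exM : forall s : seq (datum L), exists o, forall c i c',
    decode c = Some (i, c') -> ~ refuted c s ->
    (forall d, d < c -> refuted d s) -> o = Some (E i).
  move=> s; have [[c [cP cmin]]|nc] :=
      pselect (exists c, ~ refuted c s /\ forall d, d < c -> refuted d s).
    exists (if decode c is Some (i, _) then Some (E i) else None).
    move=> d i d' dE dP dmin; suff -> : c = d by rewrite dE.
    by case: (ltngtP c d) => // [/dmin|/cmin].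
  by exists None => c i c' _ cP cmin; case: nc; exists c.
have [M MP] := choice exM.
exists M => S [j BS] I IS.
have Sj i : models S (psi i) -> i = j by move/(models_iso _ BS)/psiP.
have exc : exists c, `[< Q c S >].
  have /(models_iso _ BS)/(PP j).2[c Pc] : models (B j) (psi j) by apply/psiP.
  by exists (pickle (j, c)); apply/asboolP; rewrite /Q /decode pickleK.
(* The least code true in [S] is never refuted, and the finitely many smaller ones are all refuted
   from some stage on. *)
have [c /asboolP + cmin] := ex_minnP exc; rewrite {1}/Q.
case cE: (decode c) => [[i c']|//] Pc.
have ij : i = j by apply/Sj/(PP i).2; exists c'.
have [s0 s0P] : exists s0, forall d, d < c -> refuted d (mkseq I s0).
  have : forall d, d < c -> ~ Q d S.
    by move=> d dc /asboolP/cmin; rewrite leqNgt dc.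
  elim: (c) => [|b IHb] lt_b; first by exists 0.
  have [d db|s sP] := IHb; first by apply: lt_b; apply: ltnW.
  have [t tP] : exists t, refuted b (mkseq I t).
    move: (lt_b b (ltnSn b)); rewrite /refuted /Q.
    case: (decode b) => [[i1 c1]|_]; last by exists 0 => T _ [].
    exact: (PP i1).1 IS.
  exists (maxn s t) => d; rewrite ltnS leq_eqVlt => /predU1P[->|/sP R] T C.
    by apply/tP/(consistent_mkseqW _ C)/leq_maxr.
  by apply/R/(consistent_mkseqW _ C)/leq_maxl.
exists (E i), s0; split.
  by apply: iso_trans (EP i) _; rewrite ij.
move=> s s0s; apply: MP (cE) _ _.
  by move=> /(_ S (informant_consistent IS)); rewrite /Q cE.
by move=> d /s0P R T C; apply/R/(consistent_mkseqW s0s C).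
Qed.

(** * Expressing the locking property by a sentence *)

(** Induction on the last entry [a]: a transposition corrects the value at the new position and
    leaves the earlier values alone, since [a] is new and [g] is injective. *)
Lemma extend_uniq_to_bijection (y : seq nat) :
  uniq y -> exists2 g : nat -> nat, bijective g & mkseq g (size y) = y.
Proof.
elim/last_ind: y => [_|y a IHy]; first by exists id => //; exists id.
rewrite rcons_uniq => /andP[ay /IHy[g gB gy]].
pose swap z := if z == a then g (size y) else if z == g (size y) then a else z.
have swapK : involutive swap.
  move=> z; rewrite /swap; case: (eqVneq z a) => [->|za].
    by rewrite eqxx; case: eqVneq.
  by case: (eqVneq z (g (size y))) => [->|zg]; rewrite ?eqxx // (negPf za) (negPf zg).
exists (swap \o g); first exact: bij_comp (inv_bij swapK) gB.
rewrite size_rcons mkseqS; congr rcons; last first.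
  by rewrite /= /swap eqxx; case: eqP.
rewrite -[RHS]gy; apply/eq_in_map => i; rewrite mem_iota /= => iy.
rewrite /swap; case: eqVneq => [ga|_].
  by move: ay; rewrite -gy -ga map_f // mem_iota.
by rewrite (inj_eq (bij_inj gB)) (ltn_eqF iy).
Qed.

Lemma extend_tuple_to_bijection n (y : n.-tuple nat) :
  uniq y -> exists2 g : nat -> nat, bijective g & mkseq g n = y.
Proof. by move/extend_uniq_to_bijection; rewrite size_tuple. Qed.

Lemma mkseq_nth_tuple n (y : n.-tuple nat) : mkseq (nth 0 y) n = y.
Proof. by rewrite -[RHS](mkseq_nth 0) size_tuple. Qed.

Definition pullback (L : signature) (S : structure L) (g : nat -> nat) :
  structure L := fun j a => S j (map_tuple g a).

Definition qall (L : signature) n (A : Type) (s : seq A)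
    (F : A -> qform L n) : qform L n :=
  foldr (fun a f => QAnd (F a) f) (QNot (QFalse L n)) s.

Lemma qsat_qall (L : signature) (S : structure L) n v (A : eqType) s
    (F : A -> qform L n) :
  qsat S v (qall s F) <-> forall a, a \in s -> qsat S v (F a).
Proof.
elim: s => [|a s IHs] /=; first by split=> // _ [].
rewrite IHs; split=> [[Fa Fs] b|Fs]; first by rewrite inE => /predU1P[->|/Fs].
by split=> [|b bs]; apply: Fs; rewrite inE ?eqxx ?bs ?orbT.
Qed.

(* Numbers above n would be sent to 0 by inord: only meaningful if s is bounded
   by n. It also says that the n.+1 variables are pairwise distinct. *)
Definition diagram (L : signature) n (s : seq (datum L)) : qform L n.+1 :=
  QAnd
    (qall (enum {: 'I_n.+1 * 'I_n.+1}) (fun p =>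
       if p.1 == p.2 then QNot (QFalse L _) else QNot (QEq L p.1 p.2)))
    (qall s (fun d => qall (enum (symbol L)) (fun j =>
       let f := QRel (map_tuple inord (d j).1) in
       if (d j).2 then f else QNot f))).

Arguments diagram : simpl never.

Definition bounded (L : signature) n (s : seq (datum L)) :=
  forall d, d \in s -> forall j x, x \in val (d j).1 -> x <= n.

Lemma bounded_exists (L : signature) (s : seq (datum L)) :
  exists n, bounded n s.
Proof.
elim: s => [|d s [n nP]]; first by exists 0.
pose m := \max_(j : symbol L) \max_(x <- (d j).1) x.
exists (maxn m n) => e; rewrite inE => /predU1P[->|es] j x xj.
  rewrite leq_max; apply/orP; left.
  apply: leq_trans (leq_bigmax j); exact: leq_bigmax_seq.
by rewrite leq_max (nP e es j x) ?orbT.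
Qed.

Lemma boundedW (L : signature) m n (s : seq (datum L)) :
  m <= n -> bounded m s -> bounded n s.
Proof. by move=> mn sP d ds j x xj; apply: leq_trans (sP d ds j x xj) mn. Qed.

(** The bound makes [inord] faithful on the numbers in [s]. Only the values of [g] up to [n] matter,
    so any [g] extending the tuple will do. *)
Lemma qsat_diagram (L : signature) (S : structure L) n (v : n.+1.-tuple nat)
    g (s : seq (datum L)) :
    bounded n s -> mkseq g n.+1 = v ->
  qsat S v (diagram n s) <-> uniq v /\ consistent (pullback S g) s.
Proof.
move=> sn gv.
have vE (i : 'I_n.+1) : tnth v i = g i.
  by rewrite (tnth_nth 0) -gv nth_mkseq.
rewrite /diagram /= !qsat_qall.
have <- : (forall p, p \in enum {: 'I_n.+1 * 'I_n.+1} -> qsat S v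
     (if p.1 == p.2 then QNot (QFalse L _) else QNot (QEq L p.1 p.2))) <->
    uniq v.
  split=> [vI|/tuple_uniqP vI [i k] _ /=]; last first.
    by case: eqVneq => [_ []|ik /= /vI /eqP]; rewrite (negPf ik).
  apply/tuple_uniqP => i k vik; have := vI (i, k); rewrite mem_enum /=.
  by case: eqVneq => // _ /(_ isT) /=.
have atom d j : d \in s ->
    map_tuple (tnth v) (map_tuple inord (d j).1) = map_tuple g (d j).1.
  move=> ds; apply: val_inj; rewrite /= -map_comp; apply/eq_in_map => x xj.
  by rewrite /= vE inordK // ltnS (sn d ds j).
suff -> : (forall d, d \in s -> qsat S v (qall (enum (symbol L)) (fun j =>
       let f := QRel (map_tuple inord (d j).1) in
       if (d j).2 then f else QNot f))) <-> consistent (pullback S g) s by [].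
split=> C d ds; have {C} := C d ds.
  move/qsat_qall => C j; have := C j; rewrite mem_enum => /(_ isT) /=.
  by rewrite /pullback -(atom d j ds); case: ifP.
move=> C; apply/qsat_qall => j _; have := C j => /=.
by rewrite /pullback -(atom d j ds); case: ifP.
Qed.

Lemma pullback_iso (L : signature) (S : structure L) g :
  bijective g -> iso (pullback S g) S.
Proof. by move=> gB; exists g. Qed.

Lemma consistent_pullbackE (L : signature) (S : structure L) g h n s :
    bounded n s -> (forall x, x <= n -> g x = h x) ->
  consistent (pullback S g) s -> consistent (pullback S h) s.
Proof.
move=> sn gh C d ds j; have := C d ds j; rewrite /pullback.
suff -> : map_tuple g (d j).1 = map_tuple h (d j).1 by [].
by apply: val_inj; apply/eq_in_map => x /(sn d ds j)/gh.
Qed.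

(* The locking property quantifies over all permutations agreeing with g on the
   numbers up to n, so that it speaks about tuples rather than about names. *)
Definition locked (L : signature) (M : learner L) (S : structure L) s n e :=
  exists g, [/\ bijective g, consistent (pullback S g) s &
    forall t g', bijective g' -> (forall x, x <= n -> g' x = g x) ->
      consistent (pullback S g') (s ++ t) -> M (s ++ t) = e].

(** The existential tuple lists the values of [g] up to [n]; the conjunction runs over the countably
    many continuations [t], and its universal variables stand for further values of [g']. As [M] is
    fixed, a [t] with the right answer gives a trivial conjunct. *)
Lemma locked_sentence (L : signature) (M : learner L) s n e :
    bounded n s ->
  exists2 f : sentence L, is_Sigma 2 f & forall S, models S f <-> locked M S s n e.
Proof.
move=> sn; have [b bP] := choice (@bounded_exists L).
(* The index [None] carries the diagram of [s] and needs no new variables; [Some t] gets enough of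
   them to name every number in [s ++ t]. *)
pose k o := if o is Some t then b (s ++ t) else 0.
pose F o : qform L (n + k o).+1 :=
  if o is Some t then
    if M (s ++ t) == e then QNot (QFalse L _) else
    QNot (diagram _ (s ++ t))
  else diagram _ s.
exists (@IDisj L 0 unit (fun=> n.+1) (fun=>
  @IConj L n.+1 (option (seq (datum L))) k (fun o => IQf (F o)))).
  by split=> // _; exists 1 => //; split=> // o; exists 0.
have bnd t : bounded (n + b (s ++ t)) (s ++ t).
  by apply: boundedW (bP _); apply: leq_addl.
have bnd0 : bounded (n + 0) s by rewrite addn0.
move=> S.
have FP t v : qsat S v (F (Some t)) <->
    M (s ++ t) = e \/ ~ qsat S v (diagram (n + b (s ++ t)) (s ++ t)).
  rewrite /F; case: (M (s ++ t) =P e) => ne; first by split=> _; [left|case].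
  by split=> [|[]] //; right.
split=> [[_ [y /= Fy]]|[g [gB Cg lock]]].
  have [yU Cy] : uniq y /\ forall g, mkseq g n.+1 = y -> consistent (pullback S g) s.
    have := Fy None [tuple] => /= Ds.
    split=> [|g gy].
      move/(@qsat_diagram _ _ _ _ (nth 0 y) _ bnd0): Ds => /=.
      by rewrite addn0 cats0 => /(_ (mkseq_nth_tuple y))[].
    move/(@qsat_diagram _ _ _ _ g _ bnd0): Ds => /=.
    by rewrite addn0 cats0 => /(_ gy)[].
  (* Any permutation extending [y] works, because locking mentions only its values up to [n]. *)
  have [g gB gy] : exists2 g, bijective g & mkseq g n.+1 = y.
    exact: extend_tuple_to_bijection.
  exists g; split=> // [|t g' g'B g'g Ct]; first exact: Cy.
  pose z := map_tuple g' (iota_tuple (b (s ++ t)) n.+1).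
  have g'y : mkseq g' (n + b (s ++ t)).+1 = [tuple of y ++ z].
    rewrite -addSn /mkseq iotaD map_cat -[RHS]/(tval y ++ tval z).
    congr cat; rewrite -gy; apply/eq_in_map => x; rewrite mem_iota => /= xn.
    by rewrite g'g.
  have /FP[//|[]] := Fy (Some t) z.
  apply/(@qsat_diagram _ _ _ _ g' _ (bnd t)) => //; split=> //.
  by rewrite -[X in uniq X]g'y map_inj_uniq ?iota_uniq //; apply: bij_inj.
exists tt, (map_tuple g (iota_tuple n.+1 0)) => -[t|] z; last first.
  have gy : mkseq g (n + 0).+1 =
      [tuple of [tuple of [tuple] ++ map_tuple g (iota_tuple n.+1 0)] ++ z].
    by rewrite [z]tuple0 [RHS]cats0 addn0.
  apply/(qsat_diagram S bnd0 gy); split=> //.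
  by rewrite -gy map_inj_uniq ?iota_uniq //; apply: bij_inj.
apply/FP; set v := [tuple of _].
have vx x : x <= n -> nth 0 v x = g x.
  move=> xn; rewrite -[tval v]/(mkseq g n.+1 ++ tval z) nth_cat.
  by rewrite size_mkseq ltnS xn nth_mkseq.
(* If the diagram holds, its variables are distinct, so [v] extends to a permutation [g'] to which
   locking applies. *)
have [D|nD] := pselect (qsat S v (diagram (n + b (s ++ t)) (s ++ t))); last by right.
have /(qsat_diagram S (bnd t) (mkseq_nth_tuple _))[vU _] := D.
have [g' g'B g'v] := extend_tuple_to_bijection vU.
have /(qsat_diagram S (bnd t) g'v)[_ Ct] := D.
left; apply: (lock t g') => // x xn.
by rewrite -vx // -[tval v]g'v nth_mkseq // ltnS (leq_trans xn) // leq_addr.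
Qed.

(** * Existence of locking sequences *)

(** Entry [m] is read off stage [m.+1], the first one guaranteed to be long enough; later stages
    only append. *)
Lemma prefix_limit (A : Type) (x0 : A) (s : nat -> seq A) :
    (forall n, exists t, s n.+1 = s n ++ t) -> (forall n, n <= size (s n)) ->
  exists I, forall n k, k <= size (s n) -> mkseq I k = take k (s n).
Proof.
move=> sS szs.
have sD m n : exists t, s (m + n) = s m ++ t.
  elim: n => [|n [t IHn]]; first by exists [::]; rewrite addn0 cats0.
  have [u E] := sS (m + n); exists (t ++ u).
  by rewrite addnS E IHn catA.
exists (fun m => nth x0 (s m.+1) m) => n k kn; apply: (@eq_from_nth _ x0).
  by rewrite size_mkseq size_takel.
rewrite size_mkseq => i ik; rewrite nth_mkseq // nth_take //.
case: (leqP n i.+1) => [le|/ltnW le].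
  have [t] := sD n (i.+1 - n); rewrite subnKC // => ->.
  by rewrite nth_cat (leq_trans ik kn).
have [t] := sD i.+1 (n - i.+1).
by rewrite subnKC // => ->; rewrite nth_cat (szs i.+1).
Qed.

Lemma inj_surj_bijective (g : nat -> nat) :
  injective g -> (forall y, exists x, g x = y) -> bijective g.
Proof. by move=> gI /choice[h hK]; exists h => // x; apply: gI; rewrite hK. Qed.

(** The classical locking-sequence argument, with the naming of elements also left open: [M] must
    succeed on every copy of [S], including one whose naming is built in the limit. *)
Lemma locking_sequence (L : signature) (nu : nat -> structure L) M
    (S : structure L) :
    (forall T, iso S T -> forall I, informant_for I T -> exists e s0,
       iso (nu e) T /\ forall s, s0 <= s -> M (mkseq I s) = Some e) ->
  exists s n e, [/\ bounded n s, iso (nu e) S & locked M S s n (Some e)].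
Proof.
move=> learn.
have iso_pb g : bijective g -> iso S (pullback S g).
  by move=> gB; apply/iso_sym/pullback_iso.
pose sound (s : seq (datum L)) g n :=
  [/\ bijective g, bounded n s & consistent (pullback S g) s].
have [s [g [n [gsn lock]]]] : exists s g n, sound s g n /\
    forall t g', bijective g' -> (forall x, x <= n -> g' x = g x) ->
      consistent (pullback S g') (s ++ t) -> M (s ++ t) = M s.
  (* Otherwise a permutation g and an informant for the corresponding copy of S
     can be built by finite approximations, with infinitely many mind changes. *)
  apply: contrapT => nolock.
  (* Data so far, current permutation, and the bound up to which its values are frozen. *)
  pose state := (seq (datum L) * (nat -> nat) * nat)%type.
  pose sd (p : state) := sound p.1.1 p.1.2 p.2.
  have exstep (kp : nat * state) : exists q : state, sd kp.2 ->
    let: (k, p) := kp in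
    [/\ sd q, p.2 < q.2 /\ (forall x, x <= p.2 -> q.1.2 x = p.1.2 x),
        exists2 x, x <= q.2 & q.1.2 x = k,
        forall j (a : (arity j).-tuple nat), unpickle k = Some a ->
          exists2 d, d \in q.1.1 & (d j).1 = a
      & exists t u, [/\ q.1.1 = p.1.1 ++ t ++ u, 0 < size t &
          M (p.1.1 ++ t ++ u) <> M (p.1.1 ++ t)]].
    case: kp => k p /=.
    have [[gB bnd Cp]|npd] := pselect (sd p); last by exists p.
    move: p gB bnd Cp => [[s g] n] /= gB bnd Cp.
    (* If [k] codes no tuple of this arity, a true fact about the zero tuple fills the slot. *)
    pose tup (j : symbol L) : (arity j).-tuple nat :=
      odflt [tuple of nseq _ 0] (unpickle k).
    pose d : datum L := [ffun j => (tup j, `[< pullback S g (tup j) >])].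
    have [b0 b0P] := bounded_exists [:: d].
    have [h gK hK] := gB.
    (* Exceeds [n], bounds the new datum, and freezes the preimage [h k] of [k]. *)
    pose n1 := maxn n.+1 (maxn b0 (h k)).
    have bnd1 : bounded n1 (s ++ [:: d]).
      move=> f; rewrite mem_cat => /orP[fs|fd] j x xf.
        by rewrite leq_max (leq_trans (bnd f fs j x xf)) ?leqnSn.
      by rewrite !leq_max (b0P f fd j x xf) orbT.
    have C1 : consistent (pullback S g) (s ++ [:: d]).
      apply/consistent_cat; split=> // f; rewrite inE => /eqP -> j.
      by rewrite ffunE /=; case: asboolP.
    have [t [g' [g'B g'g Ct Mt]]] : exists t g', [/\ bijective g',
        forall x, x <= n1 -> g' x = g x,
        consistent (pullback S g') ((s ++ [:: d]) ++ t)
      & M ((s ++ [:: d]) ++ t) <> M (s ++ [:: d])].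
      apply: contrapT => next; apply: nolock; exists (s ++ [:: d]), g, n1.
      split=> // t g' g'B g'g Ct; apply: contrapT => Mt.
      by apply: next; exists t, g'.
    have [b1 b1P] := bounded_exists ((s ++ [:: d]) ++ t).
    exists ((s ++ [:: d]) ++ t, g', maxn n1 b1) => _ /=; split.
    - by split=> //; apply: boundedW b1P; apply: leq_maxr.
    - split=> [|x xn]; first by rewrite !leq_max ltnSn.
      by apply: g'g; rewrite leq_max leqW.
    - exists (h k); first by rewrite !leq_max leqnn !orbT.
      by rewrite g'g ?hK // !leq_max leqnn !orbT.
    - move=> j a ak; exists d; first by rewrite !mem_cat inE eqxx orbT.
      by rewrite ffunE /tup ak.
    - by exists [:: d], t; rewrite !catA.
  have [step stepP] := choice exstep.
  pose q := fix q k := if k is l.+1 then step (l, q l) else ([::], id, 0).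
  have qsd k : sd (q k).
    elim: k => [|k IHk]; first by split=> //=; exists id.
    by have /= [] := stepP (k, q k) IHk.
  have qP k := stepP (k, q k) (qsd k).
  have [J _] := informant_exists S.
  have szq : forall k, k <= size (q k).1.1.
    elim=> [|k IHk] //; have [_ _ _ _ [t [u [/= -> t0 _]]]] := qP k.
    by rewrite !size_cat -addn1 leq_add // (leq_trans t0) // leq_addr.
  have nq : forall k, k <= (q k).2.
    elim=> [|k IHk] //; have [_ [/= lt _] _ _ _] := qP k.
    exact: leq_ltn_trans lt.
  have [I IP] : exists I, forall n k, k <= size (q n).1.1 ->
      mkseq I k = take k (q n).1.1.
    apply: (prefix_limit (J 0)) => // k.
    by have [_ _ _ _ [t [u [/= -> _ _]]]] := qP k; exists (t ++ u).
  have gqD m n x : x <= (q m).2 -> (q (m + n)).1.2 x = (q m).1.2 x.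
    move=> xm; suff [] : (q (m + n)).1.2 x = (q m).1.2 x /\ x <= (q (m + n)).2 by [].
    elim: n => [|n [IHn xn]]; first by rewrite addn0.
    have [_ [/= lt E] _ _ _] := qP (m + n).
    by rewrite addnS /= E // IHn; split=> //; rewrite (leq_trans xn) // ltnW.
  (* The value at [x] is already frozen at stage [x], since the bound there is at least [x]. *)
  pose g x := (q x).1.2 x.
  have gE m x : x <= (q m).2 -> (q m).1.2 x = g x.
    move=> xm; case: (leqP m x) => [le|/ltnW le].
      by have := gqD m (x - m) x xm; rewrite subnKC.
    by have := gqD x (m - x) x (nq x); rewrite subnKC.
  have gB : bijective g.
    apply: inj_surj_bijective => [x y|k].
      rewrite -!(gE (maxn x y)) ?(leq_trans _ (nq _)) ?leq_maxl ?leq_maxr //.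
      by have [/bij_inj gI _ _] := qsd (maxn x y); apply: gI.
    have [_ _ [x /= xq xk] _ _] := qP k.
    by exists x; rewrite -(gE k.+1).
  have Cq k : consistent (pullback S g) (q k).1.1.
    have [_ bnd C] := qsd k; exact: consistent_pullbackE bnd (gE k) C.
  have Iq k : mkseq I (size (q k).1.1) = (q k).1.1.
    by rewrite (IP k) // take_size.
  have IS : informant_for I (pullback S g).
    have CI m : consistent (pullback S g) (mkseq I m).
      by rewrite (IP m) ?szq // => d /mem_take; apply: Cq.
    have iota_last m : m \in iota 0 m.+1 by rewrite mem_iota /=.
    have sound_at m j := CI m.+1 (I m) (map_f I (iota_last m)) j.
    move=> j a b; split=> [[m Im]|Sb].
      by have := sound_at m j; rewrite Im /=; case: (b); [left|right].
    have [_ _ _ /= /(_ j a (pickleK a))[d dq da] _] := qP (pickle a).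
    move: dq; rewrite -[step _]/(q (pickle a).+1) -Iq => /mapP[m _ dI]; exists m.
    have := sound_at m j; rewrite -dI; case: (d j) da => [a' b'] /= ->.
    by case: b' Sb => + Sa; case=> -[-> Sa'].
  have [e [s0 [_ MI]]] := learn _ (iso_pb g gB) I IS.
  (* The mind change of stage [s0] occurs between prefixes of length at least [s0], where [M] is
     already constant. *)
  have [_ _ _ _ [t [u [/= E t0]]]] := qP s0.
  rewrite -E; case.
  have E1 : mkseq I (size ((q s0).1.1 ++ t)) = (q s0).1.1 ++ t.
    have le : size ((q s0).1.1 ++ t) <= size (q s0.+1).1.1.
      by rewrite /= E catA [leqRHS]size_cat leq_addr.
    by rewrite (IP _ _ le) /= E catA take_size_cat.
  rewrite -[step _]/(q s0.+1) -E1 -Iq !MI // ?size_cat.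
    by rewrite (leq_trans (szq s0)) // leq_addr.
  exact: ltnW (szq s0.+1).
have [gB bnd Cs] := gsn.
(* An informant starting with [s] shows that the locked answer [M s] is the limit, hence a correct
   index. *)
have [J JS] := informant_exists (pullback S g).
have [I IS II] := informant_prepend Cs JS.
have [e [s0 [nuS MI]]] := learn _ (iso_pb g gB) I IS.
have Ms : M s = Some e.
  have [u Iu] := II s0; rewrite -(MI (size s + s0)) ?leq_addl // Iu.
  by rewrite (lock u g) // -Iu; apply: informant_consistent.
exists s, n, e; split=> //; first exact: iso_trans nuS (pullback_iso S gB).
by exists g; split=> // t g' g'B g'g Ct; rewrite -Ms; apply: lock Ct.
Qed.

Theorem theorem3p1 (L : signature) (K0 : structure L -> Prop)
    (nu : nat -> structure L) (B : nat -> structure L)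
    (K0_iso : iso_closed K0) (nu_enum : effective_enumeration K0 nu)
    (B_K0 : forall S : structure L, iso_class B S -> K0 S)
    (B_noniso : forall i j : nat, i <> j -> ~ iso (B i) (B j)) :
  InfEx_learnable nu (iso_class B) <->
  exists psi : nat -> sentence L,
    (forall i : nat, is_Sigma 2 (psi i)) /\
    (forall i j : nat, models (B j) (psi i) <-> i = j).
Proof.
split=> [[M learn]|[psi [psi2 psiP]]]; last first.
  apply: learnable_of_Sigma2 psi2 psiP => i; have [_ _ onto] := nu_enum.
  have [|e Be] := onto (B i); first by apply: B_K0; exists i; apply: iso_refl.
  by exists e; apply: iso_sym.
have ex i : exists f : sentence L, is_Sigma 2 f /\
    forall j, models (B j) f <-> i = j.
  have [|s [n [e [sn nuB lockB]]]] := @locking_sequence L nu M (B i).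
    by move=> T BT; apply: learn; exists i.
  have [f f2 fP] := locked_sentence M (Some e) sn.
  exists f; split=> // j; split=> [/fP[g [gB Cs lock]]|<-]; last exact/fP.
  have [J JS] := informant_exists (pullback (B j) g).
  have [I IS II] := informant_prepend Cs JS.
  have [|e' [s0 [nuS MI]]] := learn (pullback (B j) g) _ I IS.
    by exists j; apply/iso_sym/pullback_iso.
  have [u Iu] := II s0; have := MI (size s + s0) (leq_addl _ _).
  rewrite Iu (lock u g) // -?Iu; last exact: informant_consistent.
  (* Both limits are the same index, so [B i] and [B j] are isomorphic to the same member of the
     enumeration. *)
  case=> ee; apply: contrapT => /B_noniso; apply.
  apply: iso_trans (iso_sym nuB) _; rewrite ee.
  exact: iso_trans nuS (pullback_iso _ gB).
have [psi psiP] := choice ex.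
by exists psi; split=> i; have [] := psiP i.
Qed.
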